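(* Let $Q$ be an involutory quandle. The following are equivalent: (i) $Q$ is superconnected. (ii) $Q$ is latin and $|L_aL_b|$ is finite for every $a,b\in Q$. (iii) For every $a,b\in Q$, $\mathrm{ord}_{a,b}=|L_aL_b|$ and this number is finite and odd.
   Context: A quandle is an algebra $(Q,*,\backslash)$ satisfying $x\backslash(x*y)=y=x*(x\backslash y)$ (so every left multiplication $L_a:b\mapsto a*b$ is a bijection), $x*(y*z)=(x*y)*(x*z)$ and $x*x=x$. It is involutory if $x*(x*y)=y$, and latin if every right multiplication $R_a:b\mapsto b*a$ is also a bijection of $Q$. $Q$ may be infinite. $\mathrm{LMlt}(Q)=\langle L_a:a\in Q\rangle$; $Q$ is connected if $\mathrm{LMlt}(Q)$ is transitive on $Q$, and superconnected if every subalgebra (subset closed under $*$ and $\backslash$) is connected with respect to its own left multiplication group. $|L_aL_b|$ denotes the order of the permutation $L_aL_b$ of $Q$. For $a,b\in Q$ and $k\in\mathbb Z$ put $a^k=(L_aL_b)^i(b)$ if $k=2i$ and $a^k=(L_aL_b)^i(a)$ if $k=2i+1$ (so $a^0=b$, $a^1=a$). Then $\mathrm{ord}_{a,b}=\min\{k>0: a^k=b\}$ (infinite if no such $k$ exists). *)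

(* Defs.v *)
From HB Require Import structures.
From mathcomp Require Import all_boot all_order all_algebra.
From mathcomp Require Import boolp classical_sets.

Set Implicit Arguments.
Unset Strict Implicit.
Unset Printing Implicit Defensive.

Local Open Scope classical_set_scope.

Reserved Notation "x |> y" (at level 40, left associativity).
Reserved Notation "x \> y" (at level 40, left associativity).

HB.mixin Record isQuandle Q := {
  qmul : Q -> Q -> Q;
  qldiv : Q -> Q -> Q;
  qmulK : forall x y, qldiv x (qmul x y) = y;
  qldivK : forall x y, qmul x (qldiv x y) = y;
  qmulD : forall x y z, qmul x (qmul y z) = qmul (qmul x y) (qmul x z);
  qmulxx : forall x, qmul x x = x
}.

#[short(type="quandleType")]
HB.structure Definition Quandle := {Q of isQuandle Q}.

Notation "x |> y" := (qmul x y).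
Notation "x \> y" := (qldiv x y).

Definition involutory (Q : quandleType) := forall x y : Q, x |> (x |> y) = y.
Arguments involutory : clear implicits.

Definition latin (Q : quandleType) :=
  forall a : Q, bijective (fun b : Q => b |> a).
Arguments latin : clear implicits.

(* The symmetric group of an arbitrary, possibly infinite, type. *)
Record sym (T : Type) := MkSym {
  sym_fun :> T -> T;
  sym_inv : T -> T;
  sym_funK : cancel sym_fun sym_inv;
  sym_invK : cancel sym_inv sym_fun
}.

Section SymGroup.
Variable T : Type.
Implicit Types f g h : sym T.

Lemma symP f g : f =1 g -> f = g.
Proof.
case: f g => [f f' fK f'K] [g g' gK g'K] /= fg.
have {fg} efg : f = g by apply/funext.
have efg' : f' = g' by apply/funext => x; rewrite -{1}(g'K x) -efg fK.
case: _ / efg efg' gK g'K => efg'; case: _ / efg' => gK g'K.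
by rewrite (Prop_irrelevance fK gK) (Prop_irrelevance f'K g'K).
Qed.

Definition sym1 : sym T := @MkSym T id id (frefl id) (frefl id).

Definition symM f g : sym T :=
  @MkSym T (f \o g) (sym_inv g \o sym_inv f)
    (can_comp (@sym_funK _ f) (@sym_funK _ g))
    (can_comp (@sym_invK _ g) (@sym_invK _ f)).

Definition symV f : sym T := MkSym (@sym_invK _ f) (@sym_funK _ f).

Lemma symMA : associative symM. Proof. by move=> f g h; apply: symP. Qed.
Lemma sym1M : left_id sym1 symM. Proof. by move=> f; apply: symP. Qed.
Lemma symM1 : right_id sym1 symM. Proof. by move=> f; apply: symP. Qed.
Lemma symVM : left_inverse sym1 symV symM.
Proof. by move=> f; apply: symP => x /=; rewrite sym_funK. Qed.
Lemma symMV : right_inverse sym1 symV symM.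
Proof. by move=> f; apply: symP => x /=; rewrite sym_invK. Qed.

HB.instance Definition _ := gen_eqMixin (sym T).
HB.instance Definition _ := gen_choiceMixin (sym T).
HB.instance Definition _ :=
  isGroup.Build (sym T) symMA sym1M symM1 symVM symMV.

End SymGroup.

Definition generated (G : groupType) (A : set G) : set G :=
  smallest [set H : set G | group_closed (mem H)] A.

Definition lmul (Q : quandleType) (a : Q) : sym Q :=
  MkSym (@qmulK Q a) (@qldivK Q a).

Definition LMlt (Q : quandleType) : set (sym Q) := generated (range (@lmul Q)).
Arguments LMlt : clear implicits.

Definition connected (Q : quandleType) :=
  forall x y : Q, exists2 f : sym Q, LMlt Q f & f x = y.
Arguments connected : clear implicits.

Record subquandle (Q : quandleType) := Subquandle {
  subq_set :> set Q;
  subq_mul : forall x y, subq_set x -> subq_set y -> subq_set (x |> y);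
  subq_ldiv : forall x y, subq_set x -> subq_set y -> subq_set (x \> y)
}.

Section SubquandleType.
Variables (Q : quandleType) (S : subquandle Q).

Definition subq_type := set_type S.
Implicit Types x y z : subq_type.

Definition sub_qmul x y : subq_type :=
  exist _ (sval x |> sval y)
    (mem_set (subq_mul (set_mem (svalP x)) (set_mem (svalP y)))).
Definition sub_qldiv x y : subq_type :=
  exist _ (sval x \> sval y)
    (mem_set (subq_ldiv (set_mem (svalP x)) (set_mem (svalP y)))).

Lemma sub_qmulK x y : sub_qldiv x (sub_qmul x y) = y.
Proof. by apply: val_inj; apply: qmulK. Qed.
Lemma sub_qldivK x y : sub_qmul x (sub_qldiv x y) = y.
Proof. by apply: val_inj; apply: qldivK. Qed.
Lemma sub_qmulD x y z :
  sub_qmul x (sub_qmul y z) = sub_qmul (sub_qmul x y) (sub_qmul x z).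
Proof. by apply: val_inj; apply: qmulD. Qed.
Lemma sub_qmulxx x : sub_qmul x x = x.
Proof. by apply: val_inj; apply: qmulxx. Qed.

HB.instance Definition _ :=
  isQuandle.Build subq_type sub_qmulK sub_qldivK sub_qmulD sub_qmulxx.

End SubquandleType.

Definition superconnected (Q : quandleType) :=
  forall S : subquandle Q, connected (subq_type S).
Arguments superconnected : clear implicits.

(* The least positive n satisfying P; None stands for infinity. *)
Definition least_pos (P : nat -> Prop) : option nat :=
  if pselect (exists n, (0 < n) && `[<P n>]) is left exP
  then Some (ex_minn exP) else None.

Definition gorder (G : groupType) (g : G) : option nat :=
  least_pos (fun n => (g ^+ n)%g = 1%g).

Definition expgz (G : groupType) (g : G) (i : int) : G :=
  match i with Posz n => (g ^+ n)%g | Negz n => (g ^- n.+1)%g end.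

(* The element written a^k; it also depends on b. Since %/ rounds down for a
   positive divisor, k = 2i or k = 2i + 1 with i = (k %/ 2)%Z. *)
Definition qpow (Q : quandleType) (a b : Q) (k : int) : Q :=
  expgz (lmul a * lmul b)%g (k %/ 2)%Z (if (2 %| k)%Z then b else a).

Definition qord (Q : quandleType) (a b : Q) : option nat :=
  least_pos (fun k => qpow a b k%:Z = b).

(* Main.v *)
Require Import Defs.
From mathcomp Require Import all_boot all_order all_algebra.
From mathcomp Require Import boolp classical_sets.
From mathcomp Require Import zify ring.

(** The whole proof takes place in the sequence x_k = [qpow a b k] spanned by
    two elements a and b of an involutory quandle, with x_0 = b and x_1 = a.
    Put t = L_a L_b. Since L_a and L_b are involutions, they generate a dihedral
    group in which L_b inverts t, and this gives
      L_(x_k) = t^k L_b  ([lmul_qpow])  and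
      x_i * x_j = x_(2i-j)  ([qmul_qpow]),
    so that k |-> x_k is a homomorphism from the integers with i * j = 2i - j
    onto the subquandle generated by a and b.

    All three conditions of the theorem turn out to be equivalent to:
      (C) for all a, b there is an odd N with x_N = x_0  ([odd_cycle]).

    - Superconnectedness implies (C). The subquandle of all x_k is connected.
      Its left multiplications x_j |-> x_(2i-j) preserve the set of the x_k
      with k even, so x_1, being in the orbit of x_0, equals some x_(2j).
      Multiplying by x_j on the left gives x_(2j-1) = x_0
      ([superconnected_odd_cycle]).
    - If Q is latin and t has finite order n, then L_(x_n) = t^n L_b = L_(x_0),
      and x |-> L_x is injective, hence x_n = x_0. If n were 2m, then
      x_m * x_0 = x_(2m) = x_0 = x_0 * x_0 would give x_m = x_0, thus t^m = 1,
      against the minimality of n ([latin_odd_cycle]).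
    - Under (C) the sequence is periodic enough that x_n = x_0 and t^n = 1 are
      the same condition on n, so the two orders coincide, and both are odd
      because t is killed by an odd power ([odd_cycle_orders]).
    - Under (C) the equation z * b = a has the solution z = x_((N+1)/2), because
      z * b = x_(N+1) = x_1. This z is in the subquandle generated by a and b,
      which gives superconnectedness ([odd_cycles_superconnected]). Conversely
      let z * b = a. The powers of a and b are the even powers of z and b, and
      an odd cycle is exhausted by its even powers, so z is itself a power of
      a and b, with an exponent depending on a and b only. Hence z is unique
      and Q is latin ([odd_cycles_latin]). *)

(** * Integer powers and parity *)

Section IntegerPowers.
Set Implicit Arguments.
Unset Strict Implicit.
Import GRing.Theory Num.Theory.
Local Open Scope int_scope.
Local Open Scope group_scope.

Variable G : groupType.
Implicit Types (g h : G) (i j : int).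

Lemma expgzS g i : expgz g (i + 1)%R = g * expgz g i.
Proof.
case: i => [n|[|n]].
- by rewrite (_ : (Posz n + 1)%R = Posz n.+1) ; [rewrite /= expgS|lia].
- by rewrite (_ : (Negz 0 + 1)%R = Posz 0) //= expg1 mulgV.
rewrite (_ : (Negz n.+1 + 1)%R = Negz n); last by lia.
by rewrite /= (expgSr g n.+1) invgM mulVKg.
Qed.

Lemma expgzD g i j : expgz g (i + j)%R = expgz g i * expgz g j.
Proof.
elim/int_rect: i => [|n IH|n IH]; first by rewrite add0r mul1g.
- rewrite (_ : (n.+1%:Z + j = (n%:Z + j) + 1)%R); last by lia.
  by rewrite expgzS IH mulgA -expgzS (_ : (n%:Z + 1)%R = n.+1%:Z) //; lia.
apply: (mulgI g); rewrite -expgzS mulgA -expgzS.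
rewrite (_ : (- n.+1%:Z + j + 1 = - n%:Z + j)%R); last by lia.
by rewrite IH (_ : (- n.+1%:Z + 1 = - n%:Z)%R) //; lia.
Qed.

Lemma expgzN g i : expgz g (- i)%R = (expgz g i)^-1.
Proof. by apply: (mulgI (expgz g i)); rewrite mulgV -expgzD subrr. Qed.

Lemma expgzM g i j : expgz g (i * j)%R = expgz (expgz g i) j.
Proof.
elim/int_rect: j => [|n IH|n IH]; first by rewrite mulr0.
  rewrite (_ : n.+1%:Z = n%:Z + 1)%R; last by lia.
  by rewrite expgzS mulrDr mulr1 addrC expgzD IH.
rewrite (_ : - n.+1%:Z = - (n%:Z + 1))%R; last by lia.
rewrite (_ : i * - (n%:Z + 1) = - i + i * - n%:Z)%R; last by ring.
rewrite expgzD IH expgzN; apply: (mulgI (expgz g i)).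
by rewrite mulVKg -expgzS (_ : - (n%:Z + 1) + 1 = - n%:Z)%R //; ring.
Qed.

(** The relation defining a dihedral group, propagated to all powers. *)
Lemma expgz_invol g h i : h * h = 1 -> h * g * h = g^-1 ->
  h * expgz g i = expgz g (- i)%R * h.
Proof.
move=> hh hgh; have hg : h * g = g^-1 * h by rewrite -hgh -!mulgA hh mulg1.
elim/int_rect: i => [|n IH|n IH]; first by rewrite mulg1 mul1g.
  rewrite (_ : n.+1%:Z = n%:Z + 1)%R; last by lia.
  rewrite expgzS mulgA hg -mulgA IH mulgA; congr (_ * h).
  apply: (mulgI g); rewrite mulVKg -expgzS.
  by rewrite (_ : - (n%:Z + 1) + 1 = - n%:Z)%R //; ring.
have hgV : h * g^-1 = g * h by rewrite -hgh !mulgA hh mul1g.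
rewrite opprK in IH *.
rewrite (_ : - n.+1%:Z = (- 1) + (- n%:Z))%R; last by lia.
rewrite expgzD mulgA (_ : expgz g (-1)%R = g^-1) // hgV -mulgA IH mulgA.
by rewrite -expgzS (_ : - (-1 - n%:Z) = n%:Z + 1)%R //; ring.
Qed.

(** If g has odd order, its powers have no 2-torsion: with N = 2m + 1 and
    u = g^i one has u = (u^2)^m u = u^N = 1. *)
Lemma expgz_odd_torsion g (N : nat) i : odd N -> g ^+ N = 1 ->
  expgz g (i * 2)%R = 1 -> expgz g i = 1.
Proof.
move=> oN gN; rewrite expgzM /= => g2.
have : expgz (expgz g i) N%:Z = 1.
  rewrite -expgzM mulrC expgzM /= gN.
  by case: (i) => n /=; rewrite expg1n ?invg1.
by rewrite /= -{1}(odd_double_half N) oN -mul2n expgnDr expgnA g2 expg1n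
  expg1 mulg1.
Qed.

End IntegerPowers.

Section Parity.
Local Open Scope int_scope.
Import GRing.Theory Num.Theory.

Variant parity_spec : int -> Type :=
| ParityEven i : parity_spec (i * 2)%R
| ParityOdd i : parity_spec (i * 2 + 1)%R.

Lemma parityP k : parity_spec k.
Proof.
rewrite (divz_eq k 2); have := modz_ge0 k (isT : 2%:Z != 0%R).
have := ltz_pmod k (isT : (0 < 2%:Z)%R).
case: (k %% 2)%Z => [[|[|n]]|n] // _ _; last exact: ParityOdd.
by rewrite addr0; apply: ParityEven.
Qed.

End Parity.

(** * Least positive integers *)

Section LeastPositive.
Local Open Scope nat_scope.

Lemma least_pos_ext (P P' : nat -> Prop) :
  (forall n, P n <-> P' n) -> least_pos P = least_pos P'.
Proof. by move=> PP'; congr least_pos; apply/funext => n; apply/propext. Qed.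

Variant least_pos_spec (P : nat -> Prop) : option nat -> Prop :=
| LeastPosSome n of 0 < n & P n & (forall m, 0 < m -> P m -> n <= m) :
    least_pos_spec P (Some n)
| LeastPosNone of (forall m, 0 < m -> ~ P m) : least_pos_spec P None.

Lemma least_posP (P : nat -> Prop) : least_pos_spec P (least_pos P).
Proof.
rewrite /least_pos; case: pselect => [exP|nP].
  case: ex_minnP => n /andP[n0 /asboolP Pn] minn.
  by constructor=> // m m0 Pm; apply: minn; rewrite m0; apply/asboolP.
constructor=> m m0 Pm; apply: nP; exists m.
by rewrite m0; apply/asboolP.
Qed.

End LeastPositive.

(** * Stable sets under the left multiplication group *)

Section StableSets.
Set Implicit Arguments.
Unset Strict Implicit.
Local Open Scope group_scope.

(** Invariance is an equivalence, not an implication, so that it passes to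
    inverses. *)
Lemma LMlt_stable (R : quandleType) (E : set R) :
  (forall u v : R, E (u |> v) <-> E v) ->
  forall g : sym R, LMlt R g -> forall v, E (g v) <-> E v.
Proof.
move=> EM.
apply: (smallest_sub (X := [set f : sym R | forall v, E (f v) <-> E v])).
  split; first by rewrite inE => v.
  move=> g h; rewrite !inE => /= gE hE v.
  by rewrite gE -[X in _ <-> E X](sym_invK h v) hE.
by move=> _ [u _ <-] v; apply: EM.
Qed.

End StableSets.

(** * The sequence of powers of two elements *)

Section Involutory.
Set Implicit Arguments.
Unset Strict Implicit.
Import GRing.Theory Num.Theory.
Local Open Scope int_scope.
Local Open Scope group_scope.

Variable Q : quandleType.
Hypothesis invQ : involutory Q.
Implicit Types (a b c x y z : Q) (i j k : int) (f g : sym Q) (m n N : nat).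

Lemma lmul_lmul a : lmul a * lmul a = 1.
Proof. by apply: symP => x /=; apply: invQ. Qed.

Lemma lmulV a : (lmul a)^-1 = lmul a.
Proof. by apply: (mulgI (lmul a)); rewrite mulgV lmul_lmul. Qed.

Lemma qldivE a b : a \> b = a |> b.
Proof. by rewrite -{1}(invQ a b) qmulK. Qed.

(** Every automorphism f of the quandle has this property, which is all that
    is needed to compute the left multiplications by the x_k. *)
Definition lmul_equivariant f := forall x, lmul (f x) = f * lmul x * f^-1.

Lemma lmul_equivariantM f g :
  lmul_equivariant f -> lmul_equivariant g -> lmul_equivariant (f * g).
Proof. by move=> ff gg x; rewrite /= ff gg invgM !mulgA. Qed.

Lemma lmul_equivariantV f : lmul_equivariant f -> lmul_equivariant f^-1.
Proof.
move=> ff x; rewrite invgK -{2}(sym_invK f x) ff.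
by rewrite !mulgA mulVg mul1g -mulgA mulVg mulg1.
Qed.

Lemma lmul_equivariant_lmul a : lmul_equivariant (lmul a).
Proof. by move=> x; apply: symP => y /=; rewrite -{1}(qldivK a y) -qmulD. Qed.

Lemma lmul_equivariantXz f i :
  lmul_equivariant f -> lmul_equivariant (expgz f i).
Proof.
move=> ff; have fX n : lmul_equivariant (f ^+ n).
  elim: n => [|n IH]; first by move=> x; rewrite expg0 invg1 mulg1 mul1g.
  by rewrite expgS; apply: lmul_equivariantM.
by case: i => n /=; [|apply: lmul_equivariantV].
Qed.

Section TwoGenerators.
Variables a b : Q.
Let t := lmul a * lmul b.

Lemma qpow_even i : qpow a b (i * 2)%R = expgz t i b.
Proof. by rewrite /qpow mulzK // dvdz_mull. Qed.

Lemma qpow_odd i : qpow a b (i * 2 + 1)%R = expgz t i a.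
Proof.
rewrite /qpow divzMDl // divz_small // addr0.
by case: dvdzP => // -[q]; lia.
Qed.

Lemma qpow0 : qpow a b 0 = b. Proof. exact: (qpow_even 0). Qed.
Lemma qpow1 : qpow a b 1 = a. Proof. exact: (qpow_odd 0). Qed.

Lemma qpowD i k : qpow a b (i * 2 + k)%R = expgz t i (qpow a b k).
Proof.
case: (parityP k) => j.
  by rewrite -mulrDl !qpow_even expgzD.
by rewrite addrA -mulrDl !qpow_odd expgzD.
Qed.

Lemma lmul_expgz i : lmul b * expgz t i = expgz t (- i)%R * lmul b.
Proof.
apply: expgz_invol; first exact: lmul_lmul.
by rewrite invgM !lmulV -!mulgA lmul_lmul mulg1.
Qed.

Lemma qpowN k : qpow a b (- k)%R = b |> qpow a b k.
Proof.
have E i x : b |> expgz t i x = expgz t (- i)%R (b |> x).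
  exact: (congr1 (fun f : sym Q => f x) (lmul_expgz i)).
case: (parityP k) => j.
  by rewrite -mulNr !qpow_even E qmulxx.
rewrite (_ : - (j * 2 + 1) = (- j - 1) * 2 + 1)%R; last by ring.
rewrite !qpow_odd E expgzD; congr (expgz t _ _).
by rewrite (_ : expgz t (- 1)%R = lmul b * lmul a) /= ?qmulxx //
  invgM !lmulV.
Qed.

(** For k = 2i this is t^i L_b t^(-i), and L_b t^(-i) = t^i L_b; for k = 2i + 1
    one uses L_a = t L_b in the same way. *)
Lemma lmul_qpow k : lmul (qpow a b k) = expgz t k * lmul b.
Proof.
have eqv i : lmul_equivariant (expgz t i).
  by apply/lmul_equivariantXz/lmul_equivariantM; apply: lmul_equivariant_lmul.
have bV i : lmul b * (expgz t i)^-1 = expgz t i * lmul b.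
  by rewrite -expgzN lmul_expgz opprK.
case: (parityP k) => j.
  rewrite qpow_even eqv -mulgA bV mulgA -expgzD.
  by congr (expgz _ _ * _); ring.
have ab : lmul a = t * lmul b by rewrite -mulgA lmul_lmul mulg1.
rewrite qpow_odd eqv ab -(mulgA (expgz t j)) -(mulgA t) bV.
rewrite (mulgA t) -expgzS mulgA -expgzD.
by congr (expgz _ _ * _); ring.
Qed.

(** Left multiplication by x_i is t^i after L_b; L_b negates the indices and
    t^i translates them by 2i. *)
Lemma qmul_qpow i j : qpow a b i |> qpow a b j = qpow a b (2 * i - j)%R.
Proof.
have := congr1 (fun f : sym Q => f (qpow a b j)) (lmul_qpow i).
by rewrite /= => ->; rewrite -qpowN -qpowD mulrC.
Qed.

Lemma qpow_eq0 k : qpow a b k = b -> expgz t k = 1.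
Proof.
by move=> kb; apply: (mulIg (lmul b)); rewrite -lmul_qpow kb mul1g.
Qed.

Definition odd_cycle N := odd N /\ qpow a b N%:Z = b.

Lemma odd_cycle_expg N : odd_cycle N -> t ^+ N = 1.
Proof. by case=> _ /qpow_eq0. Qed.

(** Odd torsion lets every even translation with t^(2i) = 1 be halved. So if
    t^n = 1, then x_n = x_0 for even n, while for odd n the even number N - n
    translates x_n to x_N = b. *)
Lemma qpow_eq0_expg N n : odd_cycle N -> qpow a b n%:Z = b <-> t ^+ n = 1.
Proof.
move=> cN; have [oN Nb] := cN; have tN := odd_cycle_expg cN.
split=> [/qpow_eq0 //|tn].
have tn' : expgz t n%:Z = 1 by [].
case: (parityP n%:Z) tn' => i => [|tn'].
  by move/(expgz_odd_torsion oN tN); rewrite qpow_even => ->.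
have [j Nj] : exists j : int, (N%:Z = j * 2 + (i * 2 + 1))%R.
  exists ((N./2)%:Z - i)%R; have := odd_double_half N; rewrite oN; lia.
have tj : expgz t j = 1.
  apply: (expgz_odd_torsion oN tN); apply: (mulIg (expgz t (i * 2 + 1)%R)).
  by rewrite -expgzD -Nj mul1g tn' /= tN.
by rewrite -[RHS]Nb Nj (qpowD j) tj.
Qed.

(** The even powers already contain a: for m = (N + 1)/2, left multiplication by
    x_m sends the equal elements x_N and x_0 to x_1 and x_(2m). *)
Lemma odd_cycle_double N : odd_cycle N -> qpow a b (N.+1./2 * 2)%:Z = a.
Proof.
case=> oN Nb; set m := N.+1./2.
have mN : ((m * 2)%:Z = N%:Z + 1)%R.
  by have := odd_double_half N; rewrite oN /m; lia.
have : qpow a b m%:Z |> qpow a b N%:Z = qpow a b m%:Z |> qpow a b 0.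
  by rewrite Nb qpow0.
rewrite !qmul_qpow (_ : 2 * m%:Z - 0 = (m * 2)%:Z)%R; last by lia.
rewrite (_ : 2 * m%:Z - N%:Z = 1)%R; last by lia.
by rewrite qpow1 => <-.
Qed.

(** A right division inside the subquandle generated by a and b. *)
Lemma odd_cycle_rdiv N : odd_cycle N -> qpow a b (N.+1./2)%:Z |> b = a.
Proof.
move=> cN; rewrite -{2}qpow0 qmul_qpow subr0 -[RHS](odd_cycle_double cN).
by congr qpow; rewrite mulrC.
Qed.

End TwoGenerators.

Lemma qpow2 a b : qpow a b 2 = a |> b.
Proof. by have := qmul_qpow a b 1 0; rewrite qpow1 qpow0. Qed.

(** Replacing the generator x_1 by x_2 replaces t by t^2. *)
Lemma qpow_double a b k : qpow (a |> b) b k = qpow a b (2 * k)%R.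
Proof.
have tt i :
    expgz (lmul (a |> b) * lmul b) i = expgz (lmul a * lmul b) (2 * i)%R.
  by rewrite -qpow2 lmul_qpow -mulgA lmul_lmul mulg1 -expgzM.
case: (parityP k) => i.
  by rewrite mulrA !qpow_even tt.
rewrite (_ : 2 * (i * 2 + 1) = 2 * i * 2 + 2)%R; last by ring.
by rewrite qpow_odd tt qpowD qpow2.
Qed.

(** * Odd cycles and the three conditions *)

(** Existence of right quotients is [odd_cycle_rdiv]. For uniqueness, let
    c = x * a. Since L_c L_a = (L_x L_a)^2 and L_x L_a has odd order, every odd
    cycle length N of (c, a) is also one of (x, a), and then
    x = [qpow x a (N + 1)] = [qpow c a ((N + 1)/2)] depends on c and a only. *)
Lemma odd_cycles_latin :
  (forall a b, exists N, odd_cycle a b N) -> latin Q.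
Proof.
move=> cyc a; pose h N c := qpow c a (N.+1./2)%:Z.
have [n cn] := choice (fun c => cyc c a).
exists (fun c => h (n c) c) => [x|c]; last exact: odd_cycle_rdiv.
rewrite /h qpow_double.
have [N cN] := cyc x a.
have [oc _] := cn (x |> a).
(* The length attached to (x * a, a) has to serve for (x, a) itself. *)
suff cx : odd_cycle x a (n (x |> a)).
  by rewrite -[RHS](odd_cycle_double cx); congr qpow; lia.
split=> //; apply/(qpow_eq0_expg _ cN).
have tN := odd_cycle_expg cN; have [oN _] := cN.
apply: (expgz_odd_torsion (i := (n (x |> a))%:Z) oN tN).
have := qpow_eq0 (cn (x |> a)).2.
rewrite -qpow2 lmul_qpow -mulgA lmul_lmul.
by rewrite mulg1 -expgzM mulrC.
Qed.

(** Right cancellation makes x |-> L_x injective, so x_n = b where n is the order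
    of t; an even n would make x_(n/2) equal to b as well, by right cancellation
    of b. *)
Lemma latin_odd_cycle a b n : latin Q ->
  gorder (lmul a * lmul b) = Some n -> odd_cycle a b n.
Proof.
move=> latQ; rewrite /gorder; case: least_posP => // {}n n0 tn min_n [<-].
have xn : qpow a b n%:Z = b.
  apply: (bij_inj (latQ b)); rewrite -[RHS]/(lmul b b) -[LHS]/(lmul _ b).
  by rewrite lmul_qpow /= tn.
split=> //; apply: contraT => en.
have n2 : n = (n./2).*2 by rewrite -[LHS]odd_double_half (negbTE en).
have xm : qpow a b (n./2)%:Z = b.
  apply: (bij_inj (latQ b)); rewrite qmulxx -[X in _ |> X](qpow0 a b).
  rewrite qmul_qpow subr0 -[RHS]xn; congr qpow; lia.
have := min_n n./2 _ (qpow_eq0 xm); lia.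
Qed.

Lemma odd_cycle_orders a b N : odd_cycle a b N ->
  qord a b = gorder (lmul a * lmul b) /\
  exists2 n : nat, gorder (lmul a * lmul b) = Some n & odd n.
Proof.
move=> cN; split.
  by apply: least_pos_ext => n; apply: (qpow_eq0_expg _ cN).
have tN := odd_cycle_expg cN; have oN := cN.1.
rewrite /gorder; case: least_posP => [n n0 tn min_n|]; last first.
  by move/(_ N); rewrite odd_gt0 // => /(_ isT).
exists n => //; apply: contraT => en.
have n2 : n = (n./2).*2 by rewrite -[LHS]odd_double_half (negbTE en).
have tm : expgz (lmul a * lmul b) (n./2)%:Z = 1.
  apply: (expgz_odd_torsion oN tN); rewrite (_ : (_ * 2)%R = n%:Z) //; lia.
have := min_n n./2 _ tm; lia.
Qed.

Lemma orders_odd_cycle a b n : qord a b = Some n -> odd n -> odd_cycle a b n.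
Proof.
by rewrite /qord; case: least_posP => // {}n n0 xn _ [<-].
Qed.

(** Each term is a product of the two preceding ones: x_(n+2) = x_(n+1) * x_n. *)
Lemma subquandle_qpow (S : subquandle Q) a b n :
  subq_set S a -> subq_set S b -> subq_set S (qpow a b n%:Z).
Proof.
move=> Sa Sb.
suff [] : subq_set S (qpow a b n%:Z) /\ subq_set S (qpow a b n.+1%:Z) by [].
elim: n => [|n [Sn Sn1]]; first by rewrite qpow0 qpow1.
split=> //; rewrite (_ : Posz n.+2 = 2 * n.+1%:Z - n%:Z)%R; last by lia.
by rewrite -qmul_qpow; apply: subq_mul.
Qed.

Lemma odd_cycles_superconnected :
  (forall a b, exists N, odd_cycle a b N) -> superconnected Q.
Proof.
move=> cyc S x y; have [N cN] := cyc (val y) (val x).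
pose z := qpow (val y) (val x) (N.+1./2)%:Z.
have Sz : subq_set S z by apply: subquandle_qpow; apply/set_mem/valP.
exists (lmul (exist _ z (mem_set Sz) : subq_type S)).
  by apply: sub_gen_smallest; exists (exist _ z (mem_set Sz)).
by apply: val_inj; apply: odd_cycle_rdiv.
Qed.

Section PowerSubquandle.
Variables a b : Q.

Let powers : set Q := [set x | exists k, x = qpow a b k].

Let powers_mul x y : powers x -> powers y -> powers (x |> y).
Proof. by move=> [i ->] [j ->]; exists (2 * i - j)%R; rewrite qmul_qpow. Qed.

Let powers_ldiv x y : powers x -> powers y -> powers (x \> y).
Proof. by rewrite qldivE; apply: powers_mul. Qed.

Definition power_subquandle := Subquandle powers_mul powers_ldiv.

(** The elements of even index form a stable set containing b, hence a. *)
Lemma superconnected_odd_cycle :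
  superconnected Q -> exists N, odd_cycle a b N.
Proof.
move=> /(_ power_subquandle) conn.
have Sb : powers b by exists 0%R; rewrite qpow0.
have Sa : powers a by exists 1%R; rewrite qpow1.
pose E : set (subq_type power_subquandle) :=
  fun u => exists i, val u = qpow a b (2 * i)%R.
have EM u v : E (u |> v) <-> E v.
  have [i ui] := set_mem (valP u).
  have Ei v' : E v' -> E (u |> v').
    move=> [j vj]; exists (i - j)%R.
    have -> : val (u |> v') = val u |> val v' by [].
    rewrite ui vj qmul_qpow; congr qpow; ring.
  split=> [/Ei|]; last exact: Ei.
  by rewrite (_ : u |> (u |> v) = v) //; apply: val_inj; apply: invQ.
pose b' : subq_type power_subquandle := exist _ b (mem_set Sb).
pose a' : subq_type power_subquandle := exist _ a (mem_set Sa).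
have [f Lf fb] := conn b' a'.
have : E (f b').
  by apply/(LMlt_stable EM Lf); exists 0%R; rewrite mulr0 qpow0.
rewrite fb => -[j aj]; have {}aj : a = qpow a b (2 * j)%R := aj.
have xj : qpow a b (2 * j - 1)%R = b.
  rewrite -qmul_qpow qpow1 {2}aj qmul_qpow -[RHS](qpow0 a b).
  by congr qpow; ring.
(* The index 2j - 1 may be negative, but L_b negates indices and fixes b. *)
exists (absz (2 * j - 1)%R); split; first by lia.
have [->//|->] : Posz (absz (2 * j - 1)%R) = (2 * j - 1)%R \/
    Posz (absz (2 * j - 1)%R) = (- (2 * j - 1))%R by lia.
by rewrite qpowN xj qmulxx.
Qed.
End PowerSubquandle.

End Involutory.

Theorem theorem3p6 (Q : quandleType) (invQ : involutory Q) :
  [<-> superconnected Q;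
       latin Q /\ (forall a b : Q, gorder (lmul a * lmul b)%g <> None);
       forall a b : Q, qord a b = gorder (lmul a * lmul b)%g /\
         exists2 n : nat, gorder (lmul a * lmul b)%g = Some n & odd n].
Proof.
tfae.
- move=> sc.
  have cyc (a b : Q) : exists N, odd_cycle a b N.
    exact: superconnected_odd_cycle invQ a b sc.
  split=> [|a b]; first exact: (odd_cycles_latin invQ).
  have [N cN] := cyc a b.
  by have [_ [n ->]] := odd_cycle_orders invQ cN.
- move=> [latQ fin] a b.
  case E: (gorder (lmul a * lmul b)%g) (fin a b) => [n|] // _.
  rewrite -E; apply: (odd_cycle_orders invQ).
  exact: (latin_odd_cycle invQ latQ E).
- move=> ords; apply: (odd_cycles_superconnected invQ) => a b.
  have [oab [n tn on]] := ords a b.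
  by exists n; apply: orders_odd_cycle => //; rewrite oab.
Qed.
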